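(* Let $P=\{p_1,\ldots,p_n\}$ be a finite poset and $r\ge s\ge1$. All powers of $H_{r,s}(P)$ have a linear resolution.
   Context: $K$ is a field and $S=K[x_{ij} : 1\le i\le r,\ 1\le j\le n]$ with the standard grading. A multichain of length $r$ in $P$ is a sequence $C: p_{j_1}\le\cdots\le p_{j_r}$ of elements of $P$ (repetitions allowed). For $\emptyset\ne A\subseteq[r]=\{1,\ldots,r\}$ set $u_{C,A}=\prod_{i\in A}x_{ij_i}$. $I_{r,s}(P)\subset S$ is generated by all $u_{C,A}$ with $C$ a multichain of length $r$ in $P$ and $A\subseteq[r]$, $|A|=s$. The Alexander dual $I^\vee$ of a squarefree monomial ideal $I$ is the ideal generated by the monomials $\prod_{x\in F}x$, where $F$ ranges over the sets of variables generating the minimal prime ideals of $I$. Put $H_{r,s}(P)=I_{r,s}(P)^\vee$. *)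

(* Defs.v *)
From mathcomp Require Import all_boot all_order all_algebra.
From mathcomp.multinomials Require Import mpoly.

Set Implicit Arguments.
Unset Strict Implicit.
Unset Printing Implicit Defensive.

Import Order.TTheory GRing.Theory.
Local Open Scope ring_scope.

(* Ideals are Prop-valued predicates: no decidability of membership is
   assumed. *)
Section Ideals.
Variable R : comNzRingType.
Implicit Types (G I J Q : R -> Prop).

Definition ideal_gen G : R -> Prop := fun f =>
  exists (m : nat) (a g : 'I_m -> R),
    (forall i, G (g i)) /\ f = \sum_(i < m) a i * g i.

(* For k = 0 the empty product is 1, so I^0 is the unit ideal. *)
Definition ideal_pow I (k : nat) : R -> Prop :=
  ideal_gen (fun f => exists g : 'I_k -> R,
    (forall i, I (g i)) /\ f = \prod_(i < k) g i).

Definition is_ideal I : Prop :=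
  [/\ I 0, forall f g, I f -> I g -> I (f + g) & forall a f, I f -> I (a * f)].

Definition is_prime_ideal Q : Prop :=
  [/\ is_ideal Q, ~ Q 1 & forall f g, Q (f * g) -> Q f \/ Q g].

Definition is_minimal_prime I Q : Prop :=
  [/\ is_prime_ideal Q,
      forall f, I f -> Q f
    & forall Q', is_prime_ideal Q' -> (forall f, I f -> Q' f) ->
        (forall f, Q' f -> Q f) -> forall f, Q f -> Q' f].

End Ideals.

Section Polynomials.
Variables (K : fieldType) (n : nat).
Local Notation S := {mpoly K[n]}.
Implicit Types (I : S -> Prop).

Definition vars_ideal (F : {set 'I_n}) : S -> Prop :=
  ideal_gen (fun f => exists2 i, i \in F & f = 'X_i).

Definition alexander_dual I : S -> Prop :=
  ideal_gen (fun f => exists2 F : {set 'I_n},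
    is_minimal_prime I (vars_ideal F) & f = \prod_(i in F) 'X_i).

(* A graded free resolution of the ideal I,
     ... -> F_2 -> F_1 -> F_0 -> I -> 0,
   with F_i the direct sum of the S(- gfr_shift i k), k < gfr_rank i.
   Elements of F_i are row vectors, maps are right multiplications by matrices:
   gfr_diff i is F_(i+1) -> F_i, and gfr_aug is F_0 -> S with image I.
   A matrix entry from S(-a) to S(-b) is homogeneous of degree a - b; writing
   this as mdeg m + b = a for all its monomials m makes it 0 when a < b. *)
Record graded_free_resolution I := GradedFreeResolution {
  gfr_rank : nat -> nat;
  gfr_shift : forall i, 'I_(gfr_rank i) -> nat;
  gfr_aug : 'cV[S]_(gfr_rank 0);
  gfr_diff : forall i, 'M[S]_(gfr_rank i.+1, gfr_rank i);
  gfr_aug_homog : forall k, gfr_aug k 0 \is (gfr_shift k).-homog;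
  gfr_diff_homog : forall i k l m, m \in msupp (gfr_diff i k l) ->
    (mdeg m + gfr_shift l = gfr_shift k)%N;
  gfr_image : forall f,
    I f <-> exists v : 'rV[S]_(gfr_rank 0), f = (v *m gfr_aug) 0 0;
  gfr_exact0 : forall v : 'rV[S]_(gfr_rank 0),
    v *m gfr_aug = 0 <-> exists w, v = w *m gfr_diff 0;
  gfr_exact : forall i (v : 'rV[S]_(gfr_rank i.+1)),
    v *m gfr_diff i = 0 <-> exists w, v = w *m gfr_diff i.+1
}.

(* All differentials have their entries in the graded maximal ideal. *)
Definition gfr_minimal I (F : graded_free_resolution I) : Prop :=
  forall i k l, (gfr_diff F i k l)@_0%MM = 0.

Definition has_linear_resolution I : Prop :=
  exists (F : graded_free_resolution I) (d : nat),
    gfr_minimal F /\ forall i (k : 'I_(gfr_rank F i)),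
      gfr_shift k = (d + i)%N.

End Polynomials.

Section PosetIdeals.
Variables (K : fieldType) (disp : Order.disp_t) (P : finPOrderType disp).
Variable r : nat.

(* The variables x_(i, p) are indexed by 'I_r * P, enumerated. *)
Definition nvars : nat := #|{: 'I_r * P}|.

Definition xvar (i : 'I_r) (p : P) : {mpoly K[nvars]} :=
  'X_(enum_rank (i, p)).

Definition multichain (C : r.-tuple P) : bool :=
  sorted (fun p q : P => (p <= q)%O) C.

Definition u_mon (C : r.-tuple P) (A : {set 'I_r}) : {mpoly K[nvars]} :=
  \prod_(i in A) xvar i (tnth C i).

Definition I_ideal (s : nat) : {mpoly K[nvars]} -> Prop :=
  ideal_gen (fun f => exists (C : r.-tuple P) (A : {set 'I_r}),
    [/\ multichain C, #|A| = s & f = u_mon C A]).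

Definition H_ideal (s : nat) : {mpoly K[nvars]} -> Prop :=
  alexander_dual (I_ideal s).

End PosetIdeals.

(* Main.v *)
Require Import Defs.
From mathcomp Require Import all_boot all_order all_algebra.
From mathcomp.multinomials Require Import mpoly.
From mathcomp Require Import zify.
From Stdlib Require Import ClassicalEpsilon.

(** Put m = r - s + 1.  The argument has three parts.

    Combinatorics.  The minimal primes of I_(r,s)(P) are generated by the
    minimal sets of variables meeting every u_(C,A) ([minimal_prime_min_cover]).
    Encode a set of variables, or more generally an exponent vector u, by its
    row sums cum u p i, the sum of the exponents of x_(j,p) over the first i
    indices j.  The minimal covers are the vectors with exponents at most 1,
    with cum u p r = m, and with cum u q i <= cum u p i whenever p <= q
    ([min_coverP]): in one direction one counts along a multichain, in the other
    one reads the row sums off the largest number of uncovered points on a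
    multichain.  All these conditions bound differences of row sums, so they
    scale: the products of k generators of H_(r,s)(P) are the monomials of the
    vectors with exponents at most k, with cum u p r = k m, and with the same
    monotonicity ([feasible_sums]); such a vector is split into k summands by
    rounding the row sums, as x is the sum of the floors of (x + l) / k, l < k.

    Linear quotients.  Order these monomials lexicographically, the rows
    following a linear extension of P.  If u precedes v, and x_(i,p) is the
    first variable where they differ, then some w before v divides
    x_(i,p) v: take i' > i least such that the row sums of v at p catch up
    with those of u just after i', and replace x_(i',p) by x_(i,p)
    ([feasible_exchange]).  Hence the colon ideals of this list of generators
    are generated by variables ([monomial_linear_quotients]).

    Resolution.  Linear quotients pass to syzygies: if the rows of a matrix A
    with homogeneous entries of the same degree have colon ideals generated by
    sets V_j of variables, then the kernel of A is generated by one linear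
    syzygy for each pair (j, t) with t in V_j, having x_t as its last nonzero
    entry, in place j; and these syzygies, in lexicographic order, again have
    colon ideals generated by variables ([linear_quotients_syzygy]).  Iterating
    this step gives a linear resolution ([linear_quotients_resolution]). *)

Set Implicit Arguments.
Unset Strict Implicit.
Unset Printing Implicit Defensive.

(** * Enumerations, and ideals given by generators *)

Section Listing.

(** A finite set with a strict total order is the image of some 'I_M under an
    order isomorphism. *)
Lemma ordered_listing (T : finType) (D : pred T) (lt : rel T) :
    irreflexive lt -> transitive lt ->
    (forall x y, x != y -> lt x y || lt y x) ->
  exists M (f : 'I_M -> T),
    (forall x, D x <-> exists i, f i = x) /\
    (forall i j : 'I_M, (i < j) = lt (f i) (f j)).
Proof.
move=> lt_irr lt_trans lt_tot.
pose le := fun x y => (x == y) || lt x y.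
have le_trans : transitive le.
  move=> y x z /orP[/eqP-> //|xy] /orP[/eqP<-|yz]; first by rewrite /le xy orbT.
  by rewrite /le (lt_trans _ _ _ xy yz) orbT.
have le_tot : total le.
  move=> x y; rewrite /le; case: eqVneq => //= /lt_tot /orP[->|->] //.
  by rewrite orbT.
pose s := sort le (enum D).
have s_sorted : sorted le s by apply: sort_sorted.
have s_uniq : uniq s by rewrite sort_uniq enum_uniq.
exists (size s), (tnth (in_tuple s)); split => [x|i j].
  have -> : D x = (x \in s) by rewrite mem_sort mem_enum.
  split => [/(tnthP (in_tuple s))[i ->]|[i <-]]; first by exists i.
  exact: (mem_tnth i (in_tuple s)).
have mono (a b : 'I_(size s)) : a < b -> lt (tnth (in_tuple s) a) (tnth (in_tuple s) b).
  move=> ab; pose x0 := tnth (in_tuple s) a.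
  rewrite !(tnth_nth x0) /=.
  have := sorted_ltn_nth le_trans x0 s_sorted a b (ltn_ord a) (ltn_ord b) ab.
  by rewrite /le nth_uniq ?ltn_ord // (ltn_eqF ab).
case: (ltngtP i j) => [/mono-> //|/mono ji|/val_inj->]; last by rewrite lt_irr.
by apply/esym/negP => ij; have := lt_trans _ _ _ ij ji; rewrite lt_irr.
Qed.

End Listing.

Section IdealGen.
Local Open Scope ring_scope.
Import GRing.Theory.
Variable R : comNzRingType.
Implicit Types (G J : R -> Prop).

Lemma ideal_gen_incl G f : G f -> ideal_gen G f.
Proof.
move=> Gf; exists 1%N, (fun=> 1), (fun=> f); split=> //.
by rewrite big_ord1 mul1r.
Qed.

Lemma ideal_gen_is_ideal G : is_ideal (ideal_gen G).
Proof.
split=> [|f1 f2 [m1 [a1 [g1 [Gg1 ->]]]] [m2 [a2 [g2 [Gg2 ->]]]]|b f [m [a [g [Gg ->]]]]].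
- by exists 0%N, (fun=> 0), (fun=> 0); split=> [[]//|]; rewrite big_ord0.
- exists (m1 + m2)%N, (fun i => match split i with inl j => a1 j | inr j => a2 j end),
    (fun i => match split i with inl j => g1 j | inr j => g2 j end).
  split=> [i|]; first by case: (split i).
  rewrite big_split_ord; congr (_ + _); apply: eq_bigr => i _.
    by rewrite (unsplitK (inl i)).
  by rewrite (unsplitK (inr i)).
- exists m, (fun i => b * a i), g; split=> //.
  by rewrite mulr_sumr; apply: eq_bigr => i _; rewrite mulrA.
Qed.

Lemma is_ideal_sum J (I : Type) (s : seq I) (D : pred I) (F : I -> R) :
  is_ideal J -> (forall i, D i -> J (F i)) -> J (\sum_(i <- s | D i) F i).
Proof. by case=> J0 JD _ JF; apply: big_ind. Qed.

Lemma ideal_gen_min G J f :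
  is_ideal J -> (forall g, G g -> J g) -> ideal_gen G f -> J f.
Proof.
move=> Jid GJ [m [a [g [Gg ->]]]]; apply: is_ideal_sum => // i _.
by case: Jid => _ _; apply; apply: GJ.
Qed.

End IdealGen.

Section Monomial.
Local Open Scope ring_scope.
Import GRing.Theory.
Variables (K : fieldType) (n : nat).
Local Notation S := {mpoly K[n]}.

(** The ideal generated by the monomials with exponent vector in [D], described
    by its membership criterion: every monomial of [f] is divisible by one of
    the generators. *)
Definition mon_ideal (D : 'X_{1..n} -> Prop) (f : S) : Prop :=
  forall m, m \in msupp f -> exists2 u, D u & (u <= m)%MM.

Lemma mon_ideal_is_ideal D : is_ideal (mon_ideal D).
Proof.
split=> [m|f1 f2 h1 h2 m /msuppD_le|a g hg m /msuppM_le].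
- by rewrite msupp0.
- by rewrite mem_cat => /orP[/h1|/h2].
- case/allpairsP=> -[m1 m2] /= [_ /hg[u Du um] ->].
  by exists u => //; apply: (lepm_trans um); apply: lem_addl.
Qed.

Lemma mon_ideal_incl (D : 'X_{1..n} -> Prop) u : D u -> mon_ideal D 'X_[u].
Proof. by move=> Du m /mem_msuppXP <-; exists u; rewrite // lepm_refl. Qed.

Lemma mon_ideal_min (D : 'X_{1..n} -> Prop) (J : S -> Prop) f :
  is_ideal J -> (forall u, D u -> J 'X_[u]) -> mon_ideal D f -> J f.
Proof.
move=> Jid DJ Df; rewrite [f]mpolyE big_seq.
apply: is_ideal_sum => // m /Df[u Du um].
rewrite -(submK um) mpolyXD scalerAl.
by case: Jid => _ _; apply; apply: DJ.
Qed.

Lemma ideal_gen_monomials (G : S -> Prop) (D : 'X_{1..n} -> Prop) f :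
    (forall g, G g <-> exists2 u, D u & g = 'X_[u]) ->
  ideal_gen G f <-> mon_ideal D f.
Proof.
move=> GD; split.
  apply: ideal_gen_min; first exact: mon_ideal_is_ideal.
  by move=> g /GD[u Du ->]; apply: mon_ideal_incl.
apply: mon_ideal_min; first exact: ideal_gen_is_ideal.
by move=> u Du; apply/ideal_gen_incl/GD; exists u.
Qed.

Lemma vars_idealP (V : {set 'I_n}) (f : S) :
  vars_ideal V f <-> forall m, m \in msupp f -> exists2 t, t \in V & (0 < m t)%N.
Proof.
rewrite /vars_ideal (@ideal_gen_monomials _ (fun u => exists2 t, t \in V & u = U_(t)%MM)).
  split=> H m /H; last first.
    by case=> t tV mt; exists U_(t)%MM; [exists t | rewrite lep1mP -lt0n].
  by case=> _ [t tV ->]; rewrite lep1mP -lt0n; exists t.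
move=> g; split=> [[t tV ->]|[_ [t tV ->] ->]]; last by exists t.
by exists U_(t)%MM => //; exists t.
Qed.

Lemma vars_ideal_comb (V : {set 'I_n}) (f : S) :
  vars_ideal V f -> exists b : 'I_n -> S, f = \sum_(t in V) b t * 'X_t.
Proof.
apply: (@ideal_gen_min _ _ (fun f => exists b, _)).
  split=> [|f1 f2 [b1 ->] [b2 ->]|a g [b ->]].
  - by exists (fun=> 0); rewrite big1 // => t _; rewrite mul0r.
  - exists (fun t => b1 t + b2 t); rewrite -big_split /=.
    by apply: eq_bigr => t _; rewrite mulrDl.
  - exists (fun t => a * b t); rewrite mulr_sumr.
    by apply: eq_bigr => t _; rewrite mulrA.
move=> g [i iV ->]; exists (fun t => (t == i)%:R).
rewrite (bigD1 i) //= eqxx mul1r big1 ?addr0 // => t /andP[_ /negPf->].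
by rewrite mul0r.
Qed.

End Monomial.

(** * Linear quotients of the rows of a matrix and their syzygies *)

Section LinearQuotients.
Local Open Scope ring_scope.
Import GRing.Theory.
Variables (K : fieldType) (n : nat).
Local Notation S := {mpoly K[n]}.

(** [v] is a linear combination of the rows of [A] with index in [D]. *)
Definition row_comb m p (A : 'M[S]_(m, p)) (D : pred 'I_m) (v : 'rV_p) :=
  exists w : 'I_m -> S, v = \sum_(i | D i) w i *: row i A.

(** [f] lies in the colon ideal (row_0, ..., row_(j-1)) : row_j. *)
Definition colon_prev m p (A : 'M[S]_(m, p)) (j : 'I_m) (f : S) :=
  row_comb A (fun i => (i < j)%N) (f *: row j A).

(** Every colon ideal of a row by the preceding ones is generated by variables. *)
Definition linear_quotients m p (A : 'M[S]_(m, p)) :=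
  forall j, exists V : {set 'I_n}, forall f, colon_prev A j f <-> vars_ideal V f.

Definition entries_homog m p (d : nat) (A : 'M[S]_(m, p)) :=
  forall i j, A i j \is d.-homog.

Section RowComb.
Variables (m p : nat) (A : 'M[S]_(m, p)).

Lemma row_comb_row (D : pred 'I_m) i : D i -> row_comb A D (row i A).
Proof.
move=> Di; exists (fun k => (k == i)%:R); rewrite (bigD1 i) //= eqxx scale1r.
by rewrite big1 ?addr0 // => k /andP[_ /negPf->]; rewrite scale0r.
Qed.

Lemma row_comb0 (D : pred 'I_m) : row_comb A D 0.
Proof. by exists (fun=> 0); rewrite big1 // => i _; rewrite scale0r. Qed.

Lemma row_combD (D : pred 'I_m) u v :
  row_comb A D u -> row_comb A D v -> row_comb A D (u + v).
Proof.
move=> [w1 ->] [w2 ->]; exists (fun i => w1 i + w2 i); rewrite -big_split /=.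
by apply: eq_bigr => i _; rewrite scalerDl.
Qed.

Lemma row_combZ (D : pred 'I_m) a v : row_comb A D v -> row_comb A D (a *: v).
Proof.
move=> [w ->]; exists (fun i => a * w i); rewrite scaler_sumr.
by apply: eq_bigr => i _; rewrite scalerA.
Qed.

Lemma row_comb_sum (D : pred 'I_m) (I : finType) (Q : pred I) (F : I -> 'rV_p) :
  (forall i, Q i -> row_comb A D (F i)) -> row_comb A D (\sum_(i | Q i) F i).
Proof. by move=> QF; apply: big_ind => //; [exact: row_comb0 | exact: row_combD]. Qed.

Lemma row_combS (D D' : pred 'I_m) v :
  (forall i, D i -> D' i) -> row_comb A D v -> row_comb A D' v.
Proof.
move=> DD' [w ->]; apply: row_comb_sum => i Di.
by apply/row_combZ/row_comb_row/DD'.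
Qed.

Lemma row_combT v : row_comb A predT v <-> exists w, v = w *m A.
Proof.
split=> [[w ->]|[w ->]].
  exists (\row_i w i); rewrite mulmx_sum_row.
  by apply: eq_bigr => i _; rewrite mxE.
by exists (fun i => w 0 i); rewrite mulmx_sum_row.
Qed.

End RowComb.

Lemma pihomogMr (d e : nat) (f g : S) :
  g \is e.-homog -> pihomog mdeg (d + e)%N (f * g) = pihomog mdeg d f * g.
Proof.
move=> ge; pose k := (msize f + d.+1)%N.
have fk : (msize f <= k)%N by rewrite leq_addr.
have dk : (d < k)%N by rewrite /k addnS ltnS leq_addl.
rewrite {1}(pihomog_partitionE fk) mulr_suml raddf_sum /=.
rewrite (bigD1 (Ordinal dk)) //= big1 ?addr0 => [|i ne_id].
  by rewrite pihomog_dE // dhomogM // pihomogP.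
apply: (@pihomog_ne0 _ _ _ (i + e)%N); last by rewrite dhomogM // pihomogP.
by rewrite eqn_add2r; apply: contraNneq ne_id => ?; apply/eqP/val_inj.
Qed.

(** If x_t multiplies row j into the span of the preceding rows, then linear
    forms suffice as coefficients: take the components of degree 1. *)
Lemma colon_prev_linear m p (A : 'M[S]_(m, p)) (e : nat) (j : 'I_m) (t : 'I_n) :
    entries_homog e A -> colon_prev A j 'X_t ->
  exists a : 'I_m -> S, (forall i, a i \is 1.-homog) /\
    'X_t *: row j A = \sum_(i < m | (i < j)%N) a i *: row i A.
Proof.
move=> Ae [w wE]; exists (fun i => pihomog mdeg 1 (w i)).
split=> [i|]; first exact: pihomogP.
apply/rowP=> c; have /(congr1 (pihomog mdeg (1 + e)%N)) :=
  congr1 (fun v : 'rV[S]_p => v 0 c) wE.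
rewrite !mxE !summxE raddf_sum /= pihomogMr //.
rewrite pihomog_dE ?dhomogX /= ?mdeg1 // => ->.
by apply: eq_bigr => i _; rewrite !mxE pihomogMr.
Qed.

(** The syzygies of a matrix with linear quotients are generated by the rows of
    a matrix of linear forms that has linear quotients in turn. *)
Lemma linear_quotients_syzygy m p (A : 'M[S]_(m, p)) (e : nat) :
    entries_homog e A -> linear_quotients A ->
  exists M (B : 'M[S]_(M, m)),
    [/\ entries_homog 1 B, linear_quotients B
      & forall v : 'rV_m, v *m A = 0 <-> exists w, v = w *m B].
Proof.
move=> Ae LQ.
pose V j := sval (constructive_indefinite_description _ (LQ j)).
have colonV j f : colon_prev A j f <-> vars_ideal (V j) f.
  by rewrite /V; case: constructive_indefinite_description.
have aP (x : 'I_m * 'I_n) : exists a : 'I_m -> S, (forall i, a i \is 1.-homog) /\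
    (x.2 \in V x.1 -> 'X_(x.2) *: row x.1 A = \sum_(i < m | (i < x.1)%N) a i *: row i A).
  case: (boolP (x.2 \in V x.1)) => [xV|_]; last first.
    by exists (fun=> 0); split=> // i; rewrite dhomog0.
  have [|a [a1 aE]] := @colon_prev_linear _ _ A e x.1 x.2 Ae; last by exists a.
  by apply/colonV/ideal_gen_incl; exists x.2.
pose a x := sval (constructive_indefinite_description _ (aP x)).
have a1 x i : a x i \is 1.-homog.
  by rewrite /a; case: constructive_indefinite_description => /= ? [].
have aE x : x.2 \in V x.1 ->
    'X_(x.2) *: row x.1 A = \sum_(i < m | (i < x.1)%N) a x i *: row i A.
  by rewrite /a; case: constructive_indefinite_description => /= ? [].
(* The syzygy attached to (j, t): x_t times row j minus its expression in the
   preceding rows. *)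
pose b (x : 'I_m * 'I_n) : 'rV[S]_m := \row_i (if (i < x.1)%N then - a x i
  else if i == x.1 then 'X_(x.2) else 0).
have b_lead x : b x 0 x.1 = 'X_(x.2) by rewrite mxE ltnn eqxx.
have b_gt (x : 'I_m * 'I_n) (i : 'I_m) : (x.1 < i)%N -> b x 0 i = 0.
  by move=> xi; rewrite mxE ltnNge (ltnW xi) /= -val_eqE gtn_eqF.
have b_syz x : x.2 \in V x.1 -> b x *m A = 0.
  move=> xV; rewrite mulmx_sum_row (bigID (fun i : 'I_m => (i < x.1)%N)) /=.
  rewrite (bigD1 (P := fun i : 'I_m => ~~ (i < x.1)%N) x.1) ?ltnn //= b_lead aE //.
  rewrite [X in _ + (_ + X)]big1 ?addr0 => [|i /andP[]]; last first.
    by rewrite mxE => /negPf-> /negPf->; rewrite scale0r.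
  rewrite -big_split big1 //= => i ix; by rewrite mxE ix scaleNr addNr.
pose lt := fun x y : 'I_m * 'I_n =>
  ((x.1 < y.1) || ((x.1 == y.1) && (x.2 < y.2)))%N.
have [||[j t] [j' t'] xy|M [f [fD f_lt]]] :=
  @ordered_listing _ (fun x : 'I_m * 'I_n => x.2 \in V x.1) lt.
- by move=> [j t]; rewrite /lt /= !ltnn andbF.
- by move=> [j t] [j' t'] [j'' t'']; rewrite /lt /= -!(inj_eq val_inj) /=; lia.
- move: xy; rewrite /lt /= xpair_eqE -!(inj_eq val_inj) /=; lia.
pose B : 'M[S]_(M, m) := \matrix_(k < M) b (f k).
have rowB k : row k B = b (f k) by apply/rowP=> i; rewrite !mxE.
have fV k : (f k).2 \in V (f k).1 by apply/fD; exists k.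
have row_of j t : t \in V j -> exists2 k, f k = (j, t) & row k B = b (j, t).
  move=> tV; have /fD[k fk] : (j, t).2 \in V (j, t).1 by [].
  by exists k; rewrite // rowB fk.
(* A syzygy whose entries from place J on vanish is a combination of the
   b (j, t) with j < J: its entry in place J - 1 lies in the ideal of V_(J-1), so
   subtracting a suitable combination of the b (J - 1, t) kills it. *)
have ker (J : nat) (v : 'rV_m) : v *m A = 0 ->
    (forall i : 'I_m, (J <= i)%N -> v 0 i = 0) ->
    row_comb B (fun k => ((f k).1 < J)%N) v.
  elim: J v => [|J IH] v vA0 v0.
    have -> : v = 0 by apply/rowP=> i; rewrite v0 // mxE.
    exact: row_comb0.
  case: (ltnP J m) => [Jm|mJ]; last first.
    apply: (@row_combS _ _ _ (fun k => ((f k).1 < J)%N)); first by move=> k /ltnW.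
    by apply: IH => // i Ji; have := ltn_ord i; rewrite ltnNge (leq_trans mJ Ji).
  pose j := Ordinal Jm.
  have : colon_prev A j (v 0 j).
    exists (fun i => - v 0 i); apply/eqP; rewrite -subr_eq0; apply/eqP.
    rewrite -[RHS]vA0 mulmx_sum_row [RHS](bigD1 j) //=; congr (_ + _).
    rewrite -sumrN [RHS](bigID (fun i : 'I_m => (i < j)%N)) /=.
    rewrite [X in _ = _ + X]big1 ?addr0 => [|i /andP[ij]]; last first.
      rewrite -leqNgt leq_eqVlt => /orP[/eqP ji|Ji]; last by rewrite v0 ?scale0r.
      by case/eqP: ij; apply/esym/val_inj.
    apply: eq_big => [i|i _]; last by rewrite scaleNr opprK.
    by apply/idP/andP=> [ij|[]//]; split=> //; apply: contraTneq ij => ->; rewrite ltnn.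
  move/colonV/vars_ideal_comb => [c vj].
  rewrite -[v](subrK (\sum_(t in V j) c t *: b (j, t))); apply: row_combD.
    apply: (@row_combS _ _ _ (fun k => ((f k).1 < J)%N)); first by move=> k /ltnW.
    apply: IH => [|i].
      rewrite mulmxBl vA0 sub0r mulmx_suml big1 ?oppr0 // => t tV.
      by rewrite -scalemxAl b_syz ?scaler0.
    rewrite leq_eqVlt !mxE summxE => /orP[/eqP/(@val_inj _ _ _ j) <-|Ji].
      rewrite vj; apply/eqP; rewrite subr_eq0; apply/eqP/eq_bigr => t _.
      by rewrite mxE b_lead.
    rewrite v0 // big1 ?subr0 // => t _; by rewrite mxE b_gt ?mulr0.
  apply: row_comb_sum => t tV; apply: row_combZ.
  have [k fk <-] := row_of _ _ tV.
  by apply: row_comb_row; rewrite fk.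
exists M, B; split.
- move=> k i; rewrite !mxE; case: ifP => _; first by rewrite rpredN a1.
  by case: ifP => _; rewrite ?dhomog0 // dhomogX /= mdeg1.
- move=> k; exists [set t in V (f k).1 | (t < (f k).2)%N] => g; split.
    (* Entry j only involves the earlier syzygies (j, t') with t' < t. *)
    case=> w; rewrite rowB => /(congr1 (fun v : 'rV[S]_m => v 0 (f k).1)).
    rewrite [LHS]mxE b_lead summxE => gE.
    have : vars_ideal [set t in V (f k).1 | (t < (f k).2)%N] (g * 'X_(f k).2).
      rewrite gE; apply: is_ideal_sum; first exact: ideal_gen_is_ideal.
      move=> k'; rewrite f_lt rowB mxE.
      case: (@ideal_gen_is_ideal S (fun f' =>
        exists2 i, i \in [set t in V (f k).1 | (t < (f k).2)%N] & f' = 'X_i)).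
      move=> id0 _ idM /orP[/b_gt->|/andP[/eqP e1 lt2]]; first by rewrite mulr0.
      apply/idM/ideal_gen_incl; exists (f k').2; last by rewrite -e1 b_lead.
      by rewrite inE lt2 -e1 fV.
    move/vars_idealP => H; apply/vars_idealP => mu mug.
    have [|t tV mut] := H (U_((f k).2) + mu)%MM.
      by rewrite (perm_mem (msuppMX _ _)); apply/mapP; exists mu.
    exists t => //; move: tV mut; rewrite inE => /andP[_ t_lt].
    by rewrite mnmDE mnm1E -val_eqE (gtn_eqF t_lt).
  move/vars_ideal_comb => [c ->]; rewrite /colon_prev scaler_suml.
  apply: row_comb_sum => t; rewrite inE => /andP[tV t_lt].
  rewrite -scalerA; apply: row_combZ.
  have [k' fk' rk'] := row_of _ _ tV.
  (* x_t' b(j, t) - x_t b(j, t') is a syzygy supported below j. *)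
  rewrite -[_ *: _](subrK ('X_(f k).2 *: row k' B)); apply: row_combD; last first.
    by apply/row_combZ/row_comb_row; rewrite f_lt fk' /lt /= eqxx t_lt orbT.
  apply: (@row_combS _ _ _ (fun k' => ((f k').1 < (f k).1)%N)).
    by move=> i; rewrite f_lt /lt => ->.
  rewrite rowB rk'; apply: ker => [|i].
    by rewrite mulmxBl -!scalemxAl !b_syz // !scaler0 subr0.
  rewrite leq_eqVlt [LHS]mxE [X in X + _]mxE [X in _ + X]mxE [X in _ - X]mxE.
  case/orP=> [/eqP/val_inj <-|fi]; last by rewrite !b_gt ?mulr0 ?subr0.
  by rewrite b_lead -[(f k).1]/(((f k).1, t).1) b_lead mulrC subrr.
- move=> v; split=> [vA0|[w ->]].
    apply/row_combT; apply: (@row_combS _ _ _ (fun k => ((f k).1 < m)%N)) => //.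
    by apply: ker => // i; rewrite leqNgt ltn_ord.
  rewrite -mulmxA; suff -> : B *m A = 0 by rewrite mulmx0.
  by apply/row_matrixP=> k; rewrite row_mul rowB b_syz // row0.
Qed.

End LinearQuotients.

(** * Linear resolutions from linear quotients *)

Section Resolution.
Local Open Scope ring_scope.
Import GRing.Theory.
Variables (K : fieldType) (n : nat).
Local Notation S := {mpoly K[n]}.

(** A matrix with linear quotients and homogeneous entries of a common degree:
    the state that is iterated to build a resolution. *)
Record lq_matrix := LqMatrix {
  lq_rows : nat;
  lq_cols : nat;
  lq_mat : 'M[S]_(lq_rows, lq_cols);
  lq_deg : nat;
  lq_homog : entries_homog lq_deg lq_mat;
  lq_quot : linear_quotients lq_mat
}.

Lemma lq_matrix_next (A : lq_matrix) :
  { B : {M & 'M[S]_(M, lq_rows A)} |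
    [/\ entries_homog 1 (tagged B), linear_quotients (tagged B)
      & forall v : 'rV_(lq_rows A),
          v *m lq_mat A = 0 <-> exists w, v = w *m tagged B] }.
Proof.
apply: constructive_indefinite_description.
have [M [B HB]] := linear_quotients_syzygy (@lq_homog A) (@lq_quot A).
by exists (Tagged (fun M => 'M[S]_(M, lq_rows A)) B).
Qed.

(** A matrix of linear syzygies of [A] provided by [linear_quotients_syzygy]. *)
Definition next_rows A := tag (sval (lq_matrix_next A)).
Definition next_mat A : 'M[S]_(next_rows A, lq_rows A) :=
  tagged (sval (lq_matrix_next A)).

Lemma next_homog A : entries_homog 1 (next_mat A).
Proof. by rewrite /next_mat /next_rows; case: lq_matrix_next => B []. Qed.

Lemma next_quot A : linear_quotients (next_mat A).
Proof. by rewrite /next_mat /next_rows; case: lq_matrix_next => B []. Qed.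

Lemma next_exact A (v : 'rV_(lq_rows A)) :
  v *m lq_mat A = 0 <-> exists w, v = w *m next_mat A.
Proof. by move: v; rewrite /next_mat /next_rows; case: lq_matrix_next => B []. Qed.

(** The matrix of syzygies; by definition its number of columns is the number of
    rows of [A], so successive matrices compose. *)
Definition lq_next A : lq_matrix := LqMatrix (@next_homog A) (@next_quot A).

Lemma linear_quotients_resolution (I : S -> Prop) m (g : 'cV[S]_m) (d : nat) :
    entries_homog d g -> linear_quotients g ->
    (forall f, I f <-> exists v : 'rV_m, f = (v *m g) 0 0) ->
  has_linear_resolution I.
Proof.
move=> gd gq gI.
pose A i := iter i lq_next (LqMatrix gd gq).
unshelve eexists (@GradedFreeResolution K n I (fun i => lq_rows (A i))
  (fun i _ => (d + i)%N) g (fun i => next_mat (A i)) _ _ gI _ _).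
- by move=> k; rewrite /= addn0; apply: gd.
- move=> i k l mu mumat; have /dhomogP/(_ _ mumat) /= -> := @next_homog (A i) k l.
  by rewrite addnS.
- exact: (@next_exact (A 0%N)).
- move=> i; exact: (@next_exact (A i.+1)).
exists d; split=> // i k l /=.
by rewrite (dhomog_nemf_coeff (@next_homog (A i) k l)) //= mdeg0.
Qed.

(** If, whenever [u i] precedes [u j], some variable x_t occurring more often in
    [u i] than in [u j] multiplies [u j] into a multiple of an earlier monomial,
    then the list of monomials has linear quotients. *)
Lemma monomial_linear_quotients M (u : 'I_M -> 'X_{1..n}) :
    (forall i j : 'I_M, (i < j)%N -> exists (k : 'I_M) t,
      [/\ (k < j)%N, (u j t < u i t)%N & (u k <= u j + U_(t))%MM]) ->
  linear_quotients (\col_i ('X_[u i] : S)).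
Proof.
move=> exch j.
pose V := [set t | [exists k : 'I_M, (k < j)%N && (u k <= u j + U_(t))%MM]].
exists V => f; split.
  case=> w /(congr1 (fun v : 'rV[S]_1 => v 0 0)); rewrite !mxE summxE => fE.
  apply/vars_idealP => mu muf.
  have : (u j + mu)%MM \in msupp (f * 'X_[u j]).
    by rewrite (perm_mem (msuppMX _ _)); apply/mapP; exists mu.
  rewrite fE => /msupp_sum_le /flatten_mapP[i].
  rewrite mem_filter => /andP[ij _]; rewrite !mxE (perm_mem (msuppMX _ _)).
  case/mapP=> nu _ muE; have [k [t [kj uij uk]]] := exch i j ij.
  exists t; first by rewrite inE; apply/existsP; exists k; rewrite kj.
  have := congr1 (fun m : 'X_{1..n} => m t) muE; rewrite /= !mnmDE; lia.
move/vars_ideal_comb => [c ->]; rewrite /colon_prev scaler_suml.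
apply: row_comb_sum => t; rewrite inE => /existsP[k /andP[kj uk]].
rewrite -scalerA; apply: row_combZ.
suff -> : 'X_t *: row j (\col_i ('X_[u i] : S)) =
  'X_[u j + U_(t) - u k] *: row k (\col_i ('X_[u i] : S)).
  exact/row_combZ/row_comb_row.
by apply/rowP=> i; rewrite !mxE -!mpolyXD submK // addmC.
Qed.

Lemma exchange_linear_resolution (D : pred 'X_{1..n}) (d : nat)
    (lt : rel 'X_{1..n}) (I : S -> Prop) :
    irreflexive lt -> transitive lt -> (forall u v, u != v -> lt u v || lt v u) ->
    (forall u, D u -> mdeg u = d) ->
    (forall u v, D u -> D v -> lt u v -> exists w t,
       [/\ D w, lt w v, (v t < u t)%N & (w <= v + U_(t))%MM]) ->
    (forall f, I f <-> forall m, m \in msupp f -> exists2 u, D u & (u <= m)%MM) ->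
  has_linear_resolution I.
Proof.
move=> lt_irr lt_trans lt_tot Ddeg exch IP.
have [|||M [f [fD f_lt]]] := @ordered_listing 'X_{1..n < d.+1} (fun u => D u)
  (fun u v => lt u v).
- by move=> u; apply: lt_irr.
- move=> v u w; exact: (@lt_trans v u w).
- by move=> u v uv; apply: lt_tot; rewrite (inj_eq val_inj).
have fP u : D u -> exists i, bmnm (f i) = u.
  move=> Du; have u_lt : (mdeg u < d.+1)%N by rewrite Ddeg.
  by have /(fD (BMultinom u_lt))[i fi] := Du; exists i; rewrite fi.
have Df i : D (f i) by apply/fD; exists i.
apply: (@linear_quotients_resolution I M (\col_i 'X_[f i]) d).
- by move=> i j; rewrite mxE dhomogX /= Ddeg.
- apply: monomial_linear_quotients => i j; rewrite f_lt => ij.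
  have [w [t [/fP[k <-] kj tij le_k]]] := exch _ _ (Df i) (Df j) ij.
  by exists k, t; rewrite f_lt.
move=> g; split=> [/IP Ig|[v ->]].
  rewrite [g]mpolyE big_seq.
  apply: (big_ind (fun g : S => exists v : 'rV_M, g = (v *m \col_i 'X_[f i]) 0 0)).
  - by exists 0; rewrite mul0mx mxE.
  - by move=> _ _ [v1 ->] [v2 ->]; exists (v1 + v2); rewrite mulmxDl [RHS]mxE.
  move=> m /Ig[u /fP[i <-] um]; exists ((g@_m *: 'X_[m - f i]) *: delta_mx 0 i).
  by rewrite -scalemxAl -rowE !mxE -scalerAl -mpolyXD submK.
apply/IP => m; rewrite mxE => /msupp_sum_le /flatten_mapP[i _].
rewrite !mxE (perm_mem (msuppMX _ _)) => /mapP[nu _ ->].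
by exists (f i) => //; apply: lem_addr.
Qed.

End Resolution.

(** * Powers of monomial ideals, minimal primes and minimal covers *)

Section MonomialPowers.
Local Open Scope ring_scope.
Import GRing.Theory.
Variables (K : fieldType) (n : nat).
Local Notation S := {mpoly K[n]}.

Lemma prod_mpolyX (I : Type) (s : seq I) (Q : pred I) (F : I -> 'X_{1..n}) :
  \prod_(i <- s | Q i) 'X_[F i] = 'X_[\big[+%MM/0%MM]_(i <- s | Q i) F i] :> S.
Proof. by rewrite (big_morph _ (@mpolyXD n K) (@mpolyX0 n K)). Qed.

(** The exponent vectors that are sums of [k] members of [D]. *)
Definition sums_of (k : nat) (D : 'X_{1..n} -> Prop) (u : 'X_{1..n}) : Prop :=
  exists g : 'I_k -> 'X_{1..n},
    (forall i, D (g i)) /\ u = \big[+%MM/0%MM]_(i < k) g i.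

Lemma prod_mon_ideal k (D : 'X_{1..n} -> Prop) (g : 'I_k -> S) :
  (forall i, mon_ideal D (g i)) -> mon_ideal (sums_of k D) (\prod_(i < k) g i).
Proof.
elim: k g => [|k IH] g gD m.
  rewrite big_ord0 msupp1 inE => /eqP->; exists 0%MM; last exact: lepm_refl.
  by exists (fun=> 0%MM); split=> [[]//|]; rewrite big_ord0.
rewrite big_ord_recl => /msuppM_le/allpairsP[[m1 m2] /= [m1g m2g ->]].
have [u1 Du1 um1] := gD ord0 m1 m1g.
have [u2 [h [hD ->]] um2] := IH _ (fun i => gD (lift ord0 i)) m2 m2g.
exists (u1 + \big[+%MM/0%MM]_(i < k) h i)%MM; last first.
  by apply/mnm_lepP=> i; rewrite !mnmDE leq_add //; apply/mnm_lepP.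
exists (fun i => if unlift ord0 i is Some j then h j else u1); split=> [i|].
  by case: unliftP => [j|].
rewrite big_ord_recl unlift_none; congr (_ + _)%MM.
by apply: eq_bigr => i _; rewrite liftK.
Qed.

Lemma ideal_pow_mon_ideal (I : S -> Prop) (D : 'X_{1..n} -> Prop) k f :
    (forall g, I g <-> mon_ideal D g) ->
  ideal_pow I k f <-> mon_ideal (sums_of k D) f.
Proof.
move=> ID; split.
  apply: ideal_gen_min; first exact: mon_ideal_is_ideal.
  by move=> _ [g [Ig ->]]; apply: prod_mon_ideal => i; apply/ID.
apply: mon_ideal_min; first exact: ideal_gen_is_ideal.
move=> _ [g [gD ->]]; apply: ideal_gen_incl; exists (fun i => 'X_[g i]).
by split=> [i|]; [apply/ID/mon_ideal_incl | rewrite prod_mpolyX].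
Qed.

End MonomialPowers.

Section MinimalPrimes.
Local Open Scope ring_scope.
Import GRing.Theory.
Variables (K : fieldType) (n : nat).
Local Notation S := {mpoly K[n]}.
Implicit Types (V F E : {set 'I_n}).

(** The substitution sending the variables in [V] to 0 and fixing the others; the
    kernel of its ring morphism is the ideal generated by [V]. *)
Definition kill_vars V : n.-tuple S := [tuple if i \in V then 0 else 'X_i | i < n].

Lemma vars_ideal_kill V (f : S) : vars_ideal V f <-> f \mPo kill_vars V = 0.
Proof.
have X_kill t : t \in V -> 'X_t \mPo kill_vars V = 0.
  by move=> tV; rewrite comp_mpolyXU -tnth_nth tnth_mktuple tV.
split.
  apply: (@ideal_gen_min _ _ (fun f : S => f \mPo kill_vars V = 0)).
    split=> [|f1 f2 h1 h2|a g hg]; first exact: comp_mpoly0.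
      by rewrite comp_mpolyD h1 h2 addr0.
    by rewrite rmorphM /= hg mulr0.
  by move=> _ [t tV ->]; apply: X_kill.
move=> f0; apply/vars_idealP => m mf; apply: NNPP => noV.
(* The substitution fixes the coefficients of the monomials avoiding V. *)
have : (f \mPo kill_vars V)@_m = f@_m.
  rewrite comp_mpolyEX raddf_sum /= [RHS](congr1 (mcoeff m) (mpolyE f)).
  rewrite [RHS]raddf_sum /=; apply: eq_bigr => u _; rewrite !mcoeffZ; congr (_ * _).
  case: (boolP [exists t, (t \in V) && (0 < u t)%N]) =>
    [/existsP[t /andP[tV ut]]|/existsPn uV].
    rewrite comp_mpolyX (bigD1 t) //= tnth_mktuple tV expr0n (gtn_eqF ut).
    rewrite mul0r mcoeff0 mcoeffX; case: eqP => // um; case: noV; exists t => //.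
    by rewrite -um.
  congr (mcoeff m _); rewrite comp_mpolyX [RHS]mpolyXE_id; apply: eq_bigr => i _.
  rewrite tnth_mktuple; case: ifP => // iV; have := uV i; rewrite iV /=.
  by rewrite lt0n negbK => /eqP->; rewrite !expr0.
by rewrite f0 mcoeff0 => /esym/eqP; rewrite mcoeff_eq0 mf.
Qed.

Lemma vars_ideal_prime V : is_prime_ideal (@vars_ideal K n V).
Proof.
split; first exact: ideal_gen_is_ideal.
  by move/vars_ideal_kill/eqP; rewrite comp_mpoly1 oner_eq0.
move=> f g /vars_ideal_kill/eqP; rewrite rmorphM mulf_eq0 => /orP[]/eqP h.
  by left; apply/vars_ideal_kill.
by right; apply/vars_ideal_kill.
Qed.

Lemma prime_ideal_prod (Q : S -> Prop) E :
  is_prime_ideal Q -> Q (\prod_(t in E) 'X_t) -> exists2 t, t \in E & Q 'X_t.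
Proof.
move=> [_ Q1 QM]; apply: (big_rec (fun f => Q f -> exists2 t, t \in E & Q 'X_t)) => //.
by move=> t f tE IH /QM[Qt|/IH //]; exists t.
Qed.

Lemma vars_idealX V t : vars_ideal V ('X_t : S) <-> t \in V.
Proof.
split=> [/vars_idealP/(_ U_(t)%MM)|tV]; last by apply: ideal_gen_incl; exists t.
rewrite msuppX inE eqxx => /(_ isT)[t' t'V]; rewrite mnm1E.
by case: eqP => // ->.
Qed.

(** [F] meets every member of the family [C]. *)
Definition covers (C : {set 'I_n} -> Prop) F : Prop :=
  forall E, C E -> exists2 t, t \in E & t \in F.

(** A cover that is minimal for inclusion. *)
Definition min_cover (C : {set 'I_n} -> Prop) F : Prop :=
  covers C F /\ forall F', covers C F' -> F' \subset F -> F' = F.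

Lemma minimal_prime_min_cover (G : S -> Prop) (C : {set 'I_n} -> Prop) F :
    (forall f, G f <-> exists2 E, C E & f = \prod_(t in E) 'X_t) ->
  is_minimal_prime (ideal_gen G) (vars_ideal F) <-> min_cover C F.
Proof.
move=> GC.
have cover_of (Q : S -> Prop) V : is_prime_ideal Q -> (forall f, ideal_gen G f -> Q f) ->
    (forall t, Q 'X_t -> t \in V) -> covers C V.
  move=> Qp GQ QV E CE; have [|t tE /QV tV] := @prime_ideal_prod Q E Qp.
    by apply/GQ/ideal_gen_incl/GC; exists E.
  by exists t.
have cover_le V : covers C V -> forall f, ideal_gen G f -> vars_ideal V f.
  move=> CV f; apply: ideal_gen_min; first exact: ideal_gen_is_ideal.
  move=> _ /GC[E /CV[t tE tV] ->]; rewrite (bigD1 t) //= mulrC.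
  have [_ _] : is_ideal (@vars_ideal K n V) by exact: ideal_gen_is_ideal.
  by apply; apply/vars_idealX.
split=> [[Fp GF Fmin]|[CF Fmin]].
  split=> [|F' CF' /subsetP FF'].
    by apply: (cover_of (vars_ideal F)) => // t /vars_idealX.
  apply/eqP; rewrite eqEsubset; apply/andP; split; apply/subsetP => // t tF.
  apply/vars_idealX; apply: Fmin; last exact/vars_idealX.
  - exact: vars_ideal_prime.
  - exact: cover_le.
  move=> f; apply: ideal_gen_min; first exact: ideal_gen_is_ideal.
  by move=> _ [i iF' ->]; apply/vars_idealX/FF'.
split; [by apply: vars_ideal_prime | by apply: cover_le | ].
move=> Q Qp GQ QF f; case: (Qp) => Qid _ _; apply: ideal_gen_min => // _ [t tF ->].
pose F' := [set t | if excluded_middle_informative (Q 'X_t) then true else false].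
have F'Q i : i \in F' <-> Q 'X_i.
  by rewrite inE; case: excluded_middle_informative.
apply/F'Q; rewrite (Fmin F') //.
  by apply: (cover_of Q) => // i /F'Q.
by apply/subsetP => i /F'Q /QF /vars_idealX.
Qed.

(** The exponent vector of the product of the variables in [F]. *)
Definition set_mnm F : 'X_{1..n} := [multinom (i \in F : nat) | i < n].

Lemma prod_vars F : \prod_(i in F) 'X_i = 'X_[set_mnm F] :> S.
Proof.
rewrite prod_mpolyX; congr 'X_[_]; apply/mnmP=> i; rewrite mnm_sumE mnmE.
case: (boolP (i \in F)) => iF.
  rewrite (bigD1 i) //= mnm1E eqxx big1 // => j /andP[_ /negPf ji].
  by rewrite mnm1E ji.
by rewrite big1 // => j jF; rewrite mnm1E; case: eqP => // ji; rewrite -ji jF in iF.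
Qed.

Lemma alexander_dual_mon_ideal (G : S -> Prop) (C : {set 'I_n} -> Prop) f :
    (forall f, G f <-> exists2 E, C E & f = \prod_(t in E) 'X_t) ->
  alexander_dual (ideal_gen G) f <->
    mon_ideal (fun u => exists2 F, min_cover C F & u = set_mnm F) f.
Proof.
move=> GC; apply: ideal_gen_monomials => g; split.
  move=> [F /(minimal_prime_min_cover _ GC) CF ->].
  by exists (set_mnm F); [exists F | rewrite prod_vars].
move=> [_ [F CF ->] ->]; exists F; last by rewrite prod_vars.
exact/(minimal_prime_min_cover _ GC).
Qed.

End MinimalPrimes.

(** * Lexicographic orders and exponent vectors with prescribed row sums *)

Section WeightedLex.
Variables (n : nat) (wt : 'I_n -> nat).
Hypothesis wt_inj : injective wt.

(** [u] precedes [v] if, at the variable of least weight where they differ, [u] has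
    the larger exponent. *)
Definition wlex (u v : 'X_{1..n}) : bool :=
  [exists t, (v t < u t) && [forall t', (wt t' < wt t) ==> (u t' == v t')]].

Lemma wlexP (u v : 'X_{1..n}) : reflect
  (exists2 t, v t < u t & forall t', wt t' < wt t -> u t' = v t') (wlex u v).
Proof.
apply: (iffP existsP) => [[t /andP[vt /forallP e]]|[t vt e]]; exists t => //.
  by move=> t' tt; apply/eqP; have := e t'; rewrite tt.
by rewrite vt; apply/forallP=> t'; apply/implyP=> /e->.
Qed.

Lemma wlex_irr : irreflexive wlex.
Proof. by move=> u; apply/wlexP => -[t]; rewrite ltnn. Qed.

Lemma wlex_trans : transitive wlex.
Proof.
move=> v u w /wlexP[t1 uv e1] /wlexP[t2 vw e2]; apply/wlexP.
case: (ltngtP (wt t1) (wt t2)) => [lt12|lt21|/wt_inj e12].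
- exists t1 => [|t' lt']; first by rewrite -e2.
  by rewrite e1 // e2 // (ltn_trans lt').
- exists t2 => [|t' lt']; first by rewrite e1.
  by rewrite e1 ?e2 // (ltn_trans lt').
- exists t1 => [|t' lt']; first by rewrite (leq_trans _ uv) // e12 ltnW.
  by rewrite e1 ?e2 -?e12.
Qed.

Lemma wlex_total u v : u != v -> wlex u v || wlex v u.
Proof.
move=> uv; have /existsP[t0 dt0] : [exists t, u t != v t].
  rewrite -negb_forall; apply: contraNN uv => /forallP e.
  by apply/eqP/mnmP=> t; apply/eqP.
case: (@arg_minnP _ t0 (fun t => u t != v t) wt dt0) => t dt tmin.
have e t' : wt t' < wt t -> u t' = v t'.
  by move=> lt'; apply/eqP; apply: contraTT lt' => /tmin; rewrite -leqNgt.
case: (ltngtP (u t) (v t)) dt => // ltuv _.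
  by rewrite orbC; apply/orP; left; apply/wlexP; exists t => // t' /e.
by apply/orP; left; apply/wlexP; exists t.
Qed.

End WeightedLex.

(** Hermite's identity for floors. *)
Lemma sum_divnD (k x : nat) : 0 < k -> \sum_(l < k) (x + l) %/ k = x.
Proof.
case: k => // k _; elim: x => [|x IH].
  by rewrite big1 // => l _; rewrite add0n divn_small.
rewrite big_ord_recr /=.
have IH' : x %/ k.+1 + \sum_(l < k) (x.+1 + l) %/ k.+1 = x.
  rewrite -[RHS]IH big_ord_recl /= addn0; congr (_ + _).
  by apply: eq_bigr => l _; rewrite /bump /= addSnnS.
have -> : (x.+1 + k) %/ k.+1 = (x %/ k.+1).+1.
  by rewrite addSnnS divnDr // divnn addn1.
by rewrite addnS addnC IH'.
Qed.

Section Feasible.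
Variables (disp : Order.disp_t) (P : finPOrderType disp) (r m : nat).
Local Notation N := (nvars P r).
Local Notation var i p := (enum_rank ((i, p) : 'I_r * P) : 'I_N).
Implicit Types (u v w : 'X_{1..N}) (p q : P).

(** The sum of the exponents of x_(j,p) over the first [i] indices j. *)
Definition cum u p (i : nat) : nat := \sum_(j < r | j < i) u (var j p).

Lemma cum0 u p : cum u p 0 = 0.
Proof. by rewrite /cum big_pred0. Qed.

Lemma cumS u p (i : 'I_r) : cum u p i.+1 = cum u p i + u (var i p).
Proof.
rewrite /cum (bigD1 i) //= addnC; congr (_ + _); apply: eq_bigl => j.
by rewrite ltnS [RHS]ltn_neqAle andbC.
Qed.

Lemma cum_ge u p i : r <= i -> cum u p i = cum u p r.
Proof.
by move=> ri; apply: eq_bigl => j; rewrite ltn_ord (leq_trans (ltn_ord j) ri).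
Qed.

Lemma cum_sum k (g : 'I_k -> 'X_{1..N}) p i :
  cum (\big[+%MM/0%MM]_(l < k) g l) p i = \sum_(l < k) cum (g l) p i.
Proof.
rewrite /cum exchange_big /=; apply: eq_bigr => j _; exact: mnm_sumE.
Qed.

(** The exponent vector whose row sums are given by [E]. *)
Definition of_cum (E : P -> nat -> nat) : 'X_{1..N} :=
  [multinom E (enum_val t).2 (enum_val t).1.+1 - E (enum_val t).2 (enum_val t).1 | t < N].

Lemma of_cumE E i p : of_cum E (var i p) = E p i.+1 - E p i.
Proof. by rewrite mnmE enum_rankK. Qed.

Lemma cum_of_cum E p i : (forall j, j < r -> E p j <= E p j.+1) -> E p 0 = 0 ->
  i <= r -> cum (of_cum E) p i = E p i.
Proof.
move=> Ei E0; elim: i => [|i IH] ir; first by rewrite cum0.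
by rewrite (@cumS _ _ (Ordinal ir)) IH 1?ltnW // of_cumE subnKC // Ei.
Qed.

(** The exponent vectors of the products of [k] generators of H_(r,s)(P), for
    m = r - s + 1; see [min_coverP] for k = 1, and [feasible_sums]. *)
Definition feasible (k : nat) u : bool :=
  [&& [forall p, cum u p r == k * m], [forall t, u t <= k]
    & [forall p, forall q, (p <= q)%O ==> [forall i : 'I_r.+1, cum u q i <= cum u p i]]].

Lemma feasibleP k u : reflect
  [/\ forall p, cum u p r = k * m, forall t, u t <= k
    & forall p q i, (p <= q)%O -> i <= r -> cum u q i <= cum u p i] (feasible k u).
Proof.
apply: (iffP and3P) => [[/forallP h1 /forallP h2 /forallP h3]|[h1 h2 h3]]; split.
- by move=> p; apply/eqP.
- exact: h2.
- move=> p q i pq ir; have /forallP/(_ q) := h3 p; rewrite pq /= => /forallP.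
  by rewrite -ltnS in ir; move/(_ (Ordinal ir)).
- by apply/forallP=> p; rewrite h1.
- exact/forallP.
- apply/forallP=> p; apply/forallP=> q; apply/implyP=> pq; apply/forallP=> i.
  by apply: h3 => //; rewrite -ltnS.
Qed.

Lemma feasible_of_cum k E :
    (forall p, E p 0 = 0) -> (forall p, E p r = k * m) ->
    (forall p i, i < r -> E p i <= E p i.+1 <= E p i + k) ->
    (forall p q i, (p <= q)%O -> i <= r -> E q i <= E p i) ->
  feasible k (of_cum E).
Proof.
move=> E0 Er Ei Epq.
have cE p i : i <= r -> cum (of_cum E) p i = E p i.
  by apply: cum_of_cum => // j /(Ei p)/andP[].
apply/feasibleP; split=> [p|t|p q i pq ir]; last by rewrite !cE // Epq.
  by rewrite cE.
rewrite -[t]enum_valK; case: (enum_val t) => i p; rewrite of_cumE leq_subLR.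
by have /andP[] := Ei p i (ltn_ord i).
Qed.

Lemma feasible_sums k u : feasible k u <-> sums_of k (feasible 1) u.
Proof.
split; last first.
  move=> [g [gD ->]]; have gP l := feasibleP _ _ (gD l).
  apply/feasibleP; split=> [p|t|p q i pq ir].
  - rewrite cum_sum (eq_bigr (fun=> m)) => [|l _].
      by rewrite sum_nat_const card_ord.
    by have [-> _ _] := gP l; rewrite mul1n.
  - rewrite mnm_sumE -[k in _ <= k]card_ord -sum1_card leq_sum // => l _.
    by have [_ -> _] := gP l.
  - by rewrite !cum_sum leq_sum // => l _; have [_ _ ->] := gP l.
move=> /feasibleP[cr uk cpq].
case: (posnP k) => [k0|k_gt0].
  subst k; exists (fun=> 0%MM); split=> [[]//|]; rewrite big_ord0.
  by apply/mnmP=> t; rewrite mnm0E; apply/eqP; rewrite -leqn0.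
(* Rounding preserves the bounds on differences of row sums. *)
exists (fun l => of_cum (fun p i => (cum u p i + l) %/ k)); split=> [l|].
  apply: feasible_of_cum => [p|p|p i ir|p q i pq ir].
  - by rewrite cum0 add0n divn_small.
  - by rewrite cr mulnC divnMDl // divn_small // addn0 mul1n.
  - rewrite (@cumS _ _ (Ordinal ir)) leq_div2r ?leq_add2r ?leq_addr //=.
    have -> : (cum u p i + l) %/ k + 1 = (cum u p i + l + k) %/ k.
      by rewrite [RHS]divnDr // divnn k_gt0.
    by rewrite leq_div2r // addnAC leq_add2l uk.
  - by rewrite leq_div2r // leq_add2r cpq.
apply/mnmP=> t; rewrite mnm_sumE -[t]enum_valK; case: (enum_val t) => i p.
under eq_bigr => l _ do rewrite of_cumE.
rewrite sumnB => [|l _]; last by rewrite leq_div2r // leq_add2r cumS leq_addr.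
by rewrite !sum_divnD // cumS addKn.
Qed.
End Feasible.

(** * The exchange property, and the covers of the multichain ideal *)

Section Exchange.
Variables (disp : Order.disp_t) (P : finPOrderType disp) (r m : nat).
Local Notation N := (nvars P r).
Local Notation var i p := (enum_rank ((i, p) : 'I_r * P) : 'I_N).
Implicit Types (u v w : 'X_{1..N}) (p q : P).

Lemma mdeg_feasible k u : feasible m k u -> mdeg u = #|P| * (k * m).
Proof.
move=> /feasibleP[cr _ _]; rewrite mdegE.
rewrite (reindex (fun x : 'I_r * P => enum_rank x)) /=; last first.
  by apply: onW_bij; apply: enum_rank_bij.
rewrite (eq_bigr (fun x => u (var x.1 x.2))) => [|[i p] _ //].
rewrite -(pair_bigA _ (fun i p => u (var i p))) exchange_big /=.
rewrite (eq_bigr (fun=> k * m)) ?sum_nat_const // => p _.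
by rewrite -(cr p); apply: eq_bigl => j; rewrite ltn_ord.
Qed.

(** An injective rank on [P] compatible with its order, that is, a linear extension:
    the number of smaller elements, with ties broken by the enumeration of [P]. *)
Definition prank p : nat := #|[set q | (q < p)%O]| * #|P| + enum_rank p.

Lemma prank_inj : injective prank.
Proof.
move=> p q e; apply/enum_rank_inj/val_inj => /=.
have := congr1 (fun x => x %% #|P|) e; rewrite /prank !modnMDl.
by rewrite !modn_small ?ltn_ord.
Qed.

Lemma prank_lt p q : (p < q)%O -> prank p < prank q.
Proof.
move=> pq; have lt_down : #|[set x | (x < p)%O]| < #|[set x | (x < q)%O]|.
  apply: proper_card; apply/properP; split.
    by apply/subsetP=> x; rewrite !inE => /Order.POrderTheory.lt_trans; apply.
  by exists p; rewrite !inE ?Order.POrderTheory.ltxx.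
apply: (@leq_trans (#|[set x | (x < p)%O]|.+1 * #|P|)).
  by rewrite /prank mulSn addnC ltn_add2r.
by apply: leq_trans (leq_addr _ _); rewrite leq_mul2r lt_down orbT.
Qed.

(** The position of a variable when rows are listed by [prank]. *)
Definition var_wt (t : 'I_N) : nat := prank (enum_val t).2 * r + (enum_val t).1.

Lemma var_wtE i p : var_wt (var i p) = prank p * r + i.
Proof. by rewrite /var_wt enum_rankK. Qed.

Lemma var_wt_inj : injective var_wt.
Proof.
move=> t1 t2; rewrite -[t1]enum_valK -[t2]enum_valK.
case: (enum_val t1) (enum_val t2) => [i p] [j q]; rewrite !var_wtE => e.
have r0 : 0 < r by apply: leq_ltn_trans (ltn_ord i).
have ij : i = j.
  have := congr1 (fun x => x %% r) e; rewrite !modnMDl !modn_small ?ltn_ord //.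
  exact: val_inj.
move: e; rewrite ij => /addIn/eqP; rewrite eqn_pmul2r // => /eqP/prank_inj->.
by [].
Qed.

Lemma feasible_exchange k u v :
    feasible m k u -> feasible m k v -> wlex var_wt u v ->
  exists w t, [/\ feasible m k w, wlex var_wt w v, v t < u t & (w <= v + U_(t))%MM].
Proof.
move=> /feasibleP[ur uk uP] /feasibleP[vr vk vP] /wlexP[t0].
rewrite -[t0]enum_valK; case: (enum_val t0) => i p vu_ip e.
have eq_row q j : (q < p)%O -> cum u q j = cum v q j.
  move=> qp; apply: eq_bigr => i' _; apply: e; rewrite !var_wtE.
  have := prank_lt qp; have := ltn_ord i'; nia.
have eq_i : cum u p i = cum v p i.
  by apply: eq_bigr => i' lt; apply: e; rewrite !var_wtE ltn_add2l.
have lt_i : cum v p i.+1 < cum u p i.+1 by rewrite !cumS eq_i ltn_add2l.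
(* The index j is the least one after i such that the row sums of v have caught
   up with those of u just after j; x_(j,p) is then traded for x_(i,p). *)
have ex_j : exists j, (i < j) && (cum u p j.+1 <= cum v p j.+1).
  exists r; rewrite ltn_ord /= ![cum _ _ r.+1]cum_ge // ur vr //.
case: (ex_minnP ex_j) => j /andP[ij le_j] jmin.
have lt_between a : i < a <= j -> cum v p a < cum u p a.
  case: a => // a /andP[]; rewrite ltnS leq_eqVlt => /orP[/eqP<- //|ia aj].
  rewrite ltnNge; apply/negP => h; have := jmin a; rewrite ia h => /(_ isT).
  by rewrite leqNgt aj.
have jr : j < r.
  rewrite ltnNge; apply/negP => rj; have := lt_between j; rewrite ij leqnn => /(_ isT).
  by rewrite !cum_ge // ur vr ltnn.
pose j' : 'I_r := Ordinal jr.
have vj_gt : u (var j' p) < v (var j' p).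
  have := lt_between j; rewrite ij leqnn => /(_ isT).
  by move: le_j; rewrite -[j]/(val j') !cumS /=; lia.
have ij' : var i p != var j' p.
  rewrite (inj_eq enum_rank_inj) xpair_eqE eqxx andbT -val_eqE /=.
  by rewrite (ltn_eqF ij).
pose w := (v + U_(var i p) - U_(var j' p))%MM.
have w_le : (w <= v + U_(var i p))%MM by apply: lem_subr.
have wE q a : w (var a q) =
    v (var a q) + ((a == i) && (q == p)) - ((a == j') && (q == p)).
  rewrite mnmBE mnmDE !mnm1E !(inj_eq enum_rank_inj) !xpair_eqE.
  by rewrite ![_ == a]eq_sym ![_ == q]eq_sym.
have w_row q a : q != p -> cum w q a = cum v q a.
  move=> /negPf qp; apply: eq_bigr => b _.
  by rewrite wE qp !andbF addn0 subn0.
have w_p a : a <= r -> cum w p a = cum v p a + ((i < a) && (a <= j)).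
  elim: a => [|a IH] ar; first by rewrite !cum0.
  rewrite !(@cumS _ _ _ _ _ (Ordinal ar)) (IH (ltnW ar)) wE eqxx !andbT -!val_eqE /=.
  have := vj_gt; have := ij.
  case: (eqVneq a j) => [aj|]; last by lia.
  have -> : Ordinal ar = j' by apply: val_inj.
  by move: (u _) (v _) => x y; lia.
exists w, (var i p); split=> //.
- apply/feasibleP; split=> [q|t|q1 q2 a q12 ar].
  + case: (eqVneq q p) => [->|qp]; last by rewrite w_row.
    by rewrite w_p // vr; lia.
  + case: (eqVneq t (var i p)) => [->|ti].
      apply: (leq_trans (mnm_lepP w_le _)); rewrite mnmDE mnm1E eqxx addn1.
      exact: leq_trans vu_ip (uk _).
    apply: (leq_trans (mnm_lepP w_le _)); rewrite mnmDE mnm1E eq_sym (negPf ti) addn0.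
    exact: vk.
  + case: (eqVneq q1 p) => [q1p|q1p]; case: (eqVneq q2 p) => [q2p|q2p].
    * by rewrite q1p q2p.
    * rewrite w_row // q1p w_p // (leq_trans _ (leq_addr _ _)) // vP // -q1p //.
    (* Row q1 precedes row p, so u and v agree there, and u leaves room for the
       increase by 1. *)
    * rewrite q2p w_p // w_row //.
      have q1p_lt : (q1 < p)%O by rewrite Order.POrderTheory.lt_neqAle q1p -q2p.
      case: (boolP (i < a <= j)) => [/lt_between lt_a|_]; last first.
        by rewrite addn0 vP // -q2p.
      rewrite addn1 (leq_trans lt_a) // -eq_row // uP //.
      exact: Order.POrderTheory.ltW.
    * by rewrite !w_row // vP.
- apply/wlexP; exists (var i p) => [|t'].
    by rewrite mnmBE mnmDE !mnm1E eqxx (eq_sym (var j' p)) (negPf ij') addn1 subn0.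
  rewrite -[t']enum_valK; case: (enum_val t') => a q; rewrite wE !var_wtE => lt_t.
  case: (eqVneq q p) lt_t => [->|_ _]; last by rewrite !andbF addn0 subn0.
  rewrite ltn_add2l !andbT -!val_eqE /= => ai; lia.
Qed.

End Exchange.

Section Covers.
Variables (disp : Order.disp_t) (P : finPOrderType disp) (r s : nat).
Hypotheses (s_gt0 : 0 < s) (s_le_r : s <= r).
Local Notation N := (nvars P r).
Local Notation var i p := (enum_rank ((i, p) : 'I_r * P) : 'I_N).
Local Notation m := (r - s).+1.
Implicit Types (u v w : 'X_{1..N}) (p q : P).

(** The sets of variables whose products are the generators u_(C,A). *)
Definition chain_sets (E : {set 'I_N}) : Prop :=
  exists (c : r.-tuple P) (A : {set 'I_r}),
    [/\ multichain c, #|A| = s & E = [set var i (tnth c i) | i in A]].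

Lemma feasible_covers (F : {set 'I_N}) :
  feasible m 1 (set_mnm F) -> covers chain_sets F.
Proof.
move=> /feasibleP[ur u1 uP] _ [c [A [c_mc As ->]]]; apply: NNPP => noF.
have AF i : i \in A -> var i (tnth c i) \notin F.
  move=> iA; apply/negP => iF; apply: noF.
  by exists (var i (tnth c i)); first exact: imset_f.
have c_le (i j : 'I_r) : i <= j -> (tnth c i <= tnth c j)%O.
  pose p0 := tnth c i; rewrite !(tnth_nth p0) => ij.
  have := sorted_leq_nth (@Order.POrderTheory.le_trans _ P)
    (@Order.POrderTheory.le_refl _ P) p0 c_mc.
  by apply => //; rewrite inE size_tuple.
(* If the chain misses F, then along it the row sums only grow at the indices
   outside A; there are only r - s of these. *)
have bound j p : j <= r -> (forall i : 'I_r, i < j -> (tnth c i <= p)%O) ->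
    cum (set_mnm F) p j <= \sum_(i < r | i < j) (i \notin A).
  elim: j p => [|j IH] p jr cp; first by rewrite cum0.
  pose j' : 'I_r := Ordinal jr.
  apply: leq_trans (uP _ _ _ (cp j' (ltnSn j)) jr) _.
  rewrite -[j]/(val j') cumS (bigD1 (P := fun i : 'I_r => i < j'.+1) j') //= addnC.
  rewrite leq_add //.
    rewrite mnmE; case: (boolP (j' \in A)) => [/AF/negPf->|_] //.
    exact: leq_b1.
  rewrite (eq_bigl (fun i : 'I_r => i < j)) => [|i]; last first.
    by rewrite ltnS [RHS]ltn_neqAle andbC.
  by apply: IH => [|i ij]; [exact: ltnW | apply: c_le; exact: ltnW].
have r_gt0 : 0 < r by apply: leq_trans s_le_r.
have last_lt : r.-1 < r by rewrite prednK.
have := bound r (tnth c (Ordinal last_lt)) (leqnn r).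
rewrite ur mul1n (eq_bigl predT) => [|i]; last exact: ltn_ord.
have -> : \sum_(i < r) (i \notin A) = #|~: A|.
  rewrite -sum1_card [RHS]big_mkcond; apply: eq_bigr => i _.
  by rewrite inE; case: (i \in A).
rewrite -(leq_add2l #|A|) cardsC As card_ord addnS subnKC // => H.
suff : r < r by rewrite ltnn.
by apply: H => i _; apply: c_le; rewrite -ltnS prednK.

Qed.

Lemma mdeg_set_mnm (F : {set 'I_N}) : mdeg (set_mnm F) = #|F|.
Proof.
rewrite mdegE -sum1_card [RHS]big_mkcond; apply: eq_bigr => t _.
by rewrite mnmE; case: (t \in F).
Qed.

(** Every cover contains the support of a feasible vector. *)
Lemma cover_feasible (F : {set 'I_N}) : covers chain_sets F ->
  exists2 F' : {set 'I_N}, F' \subset F & feasible m 1 (set_mnm F').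
Proof.
move=> cF.
(* h i p is the largest number of points outside F on a multichain of length i
   bounded by p. *)
pose b i q : bool := if insub i is Some i' then var i' q \notin F else false.
pose h := fix h i p := if i is i'.+1 then \max_(q | (q <= p)%O) (h i' q + b i' q) else 0.
have hS i p : h i.+1 p = \max_(q | (q <= p)%O) (h i q + b i q) by [].
have h_mono i p q : (p <= q)%O -> h i p <= h i q.
  case: i => // i pq; rewrite !hS; apply/bigmax_leqP => x xp.
  by apply: (bigmax_sup x) => //; apply: Order.POrderTheory.le_trans pq.
have h_step i p : h i.+1 p <= (h i p).+1.
  rewrite hS; apply/bigmax_leqP => x xp; rewrite -addn1 leq_add ?leq_b1 //.
  exact: h_mono.
have h_ge i p : h i p + b i p <= h i.+1 p.
  by rewrite hS; apply: (bigmax_sup p) => //; apply: Order.POrderTheory.le_refl.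
have h_le i p : h i p <= i.
  by elim: i => // i IH; apply: leq_trans (h_step i p) _.
(* The maximum is attained by an actual multichain; as F is a cover, fewer
   than s of its points are outside F. *)
have chain i p : exists c : seq P, [/\ size c = i, sorted (fun x y : P => (x <= y)%O) c,
    all (fun x => (x <= p)%O) c & h i p = \sum_(j < i) b j (nth p c j)].
  elim: i p => [|i IH] p; first by exists [::]; rewrite big_ord0.
  have [|q qp hq] := @eq_bigmax_cond _ (fun q => (q <= p)%O) (fun q => h i q + b i q).
    by apply/card_gt0P; exists p; exact: Order.POrderTheory.le_refl.
  rewrite unfold_in /= in qp.
  have [c [cs c_sorted cq hc]] := IH q.
  exists (rcons c q); split; first by rewrite size_rcons cs.
  - case: c cs c_sorted {cq}(allP cq) hc => //= x c _ c_sorted cq _.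
    by rewrite rcons_path c_sorted; apply: cq; apply: mem_last.
  - rewrite all_rcons qp; apply/allP => x /(allP cq) xq.
    exact: Order.POrderTheory.le_trans qp.
  rewrite hS hq big_ord_recr /= nth_rcons cs ltnn eqxx hc; congr (_ + _).
  apply: eq_bigr => j _; rewrite nth_rcons cs ltn_ord.
  by congr (nat_of_bool (b _ _)); apply: set_nth_default; rewrite cs.
have h_lt p : h r p < s.
  rewrite ltnNge; apply/negP => s_le.
  have [c [cs c_sorted _ hc]] := chain r p.
  have cs' : size c == r by rewrite cs.
  pose ct : r.-tuple P := Tuple cs'.
  pose A0 := [set j : 'I_r | var j (tnth ct j) \notin F].
  have A0h : #|A0| = h r p.
    rewrite hc -sum1_card big_mkcond; apply: eq_bigr => j _.
    by rewrite inE (tnth_nth p) /b valK; case: (_ \notin _).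
  pose A := [set x in take s (enum A0)].
  have As : #|A| = s.
    rewrite cardsE (card_uniqP _) ?take_uniq ?enum_uniq // size_take -cardE A0h.
    by case: ltngtP s_le.
  have [|t] := cF [set var i (tnth ct i) | i in A]; first by exists ct, A.
  case/imsetP=> i; rewrite inE => /mem_take; rewrite mem_enum inE => /negP iF ->.
  exact: iF.
(* i - h i p counts points of F on an optimal multichain; truncating at m makes
   the total of each row exactly m. *)
pose E p i := minn m (i - h i p).
have E_feas : feasible m 1 (of_cum r E).
  apply: feasible_of_cum => [p|p|p i ir|p q i pq ir].
  - by rewrite /E sub0n minn0.
  - by rewrite /E mul1n; have := h_lt p; lia.
  - by rewrite /E; have := h_step i p; have := h_ge i p; have := h_le i p; lia.
  - by rewrite /E; have := h_mono i _ _ pq; lia.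
exists [set t | 0 < of_cum r E t].
  apply/subsetP=> t; rewrite inE -[t]enum_valK; case: (enum_val t) => i p.
  rewrite of_cumE /E; apply: contraTT => iF.
  have : b i p by rewrite /b valK.
  by have := h_ge i p; case: (b i p) => //; lia.
suff -> : set_mnm [set t | 0 < of_cum r E t] = of_cum r E by [].
have /feasibleP[_ E1 _] := E_feas.
by apply/mnmP=> t; rewrite mnmE inE; have := E1 t; case: (of_cum r E t) => [|[]].
Qed.

Lemma min_coverP (F : {set 'I_N}) :
  min_cover chain_sets F <-> feasible m 1 (set_mnm F).
Proof.
split=> [[cF Fmin]|Ff].
  have [F' F'F F'f] := cover_feasible cF.
  by rewrite -(Fmin F') //; apply: feasible_covers.
split=> [|F' cF' F'F]; first exact: feasible_covers.
have [F'' F''F' F''f] := cover_feasible cF'.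
have F''F : F'' = F.
  apply/eqP; rewrite eqEcard (subset_trans F''F' F'F) /= -!mdeg_set_mnm.
  by rewrite (mdeg_feasible Ff) (mdeg_feasible F''f).
by apply/eqP; rewrite eqEsubset F'F -F''F F''F'.
Qed.

Lemma feasible1_set u : feasible m 1 u -> u = set_mnm [set t | 0 < u t].
Proof.
move=> /feasibleP[_ u1 _]; apply/mnmP=> t; rewrite mnmE inE.
by have := u1 t; case: (u t) => [|[]].
Qed.

Lemma H_idealP (K : fieldType) f :
  @H_ideal K disp P r s f <-> mon_ideal (feasible m 1) f.
Proof.
rewrite /H_ideal /I_ideal alexander_dual_mon_ideal.
  split=> H mu /H[u]; last first.
    move=> uf um; exists u => //; exists [set t | 0 < u t]; last exact: feasible1_set.
    by apply/min_coverP; rewrite -feasible1_set.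
  by move=> [F /min_coverP Ff ->] um; exists (set_mnm F).
move=> g.
have uE (c : r.-tuple P) (A : {set 'I_r}) :
    (\prod_(t in [set var i (tnth c i) | i in A]) 'X_t)%R = u_mon K c A.
  rewrite big_imset // => i j _ _ /enum_rank_inj[] //.
split=> [[c [A [mc As ->]]]|[_ [c [A [mc As ->]]] ->]].
  by exists [set var i (tnth c i) | i in A]; [exists c, A | rewrite uE].
by exists c, A; split=> //; rewrite uE.
Qed.

End Covers.

Theorem corollary6p5 (K : fieldType) (disp : Order.disp_t)
    (P : finPOrderType disp) (r s : nat) (hs : 1 <= s) (hsr : s <= r) (k : nat) :
  has_linear_resolution (ideal_pow (@H_ideal K disp P r s) k).
Proof.
apply: (@exchange_linear_resolution K _ (@feasible _ P r (r - s).+1 k)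
  (#|P| * (k * (r - s).+1)) (wlex (@var_wt _ P r))).
- exact: wlex_irr.
- exact: wlex_trans (@var_wt_inj _ P r).
- exact: wlex_total.
- exact: mdeg_feasible.
- exact: feasible_exchange.
move=> f; rewrite (ideal_pow_mon_ideal _ _ (fun g => H_idealP hs hsr g)).
by split=> H mu /H[u uD um]; exists u => //; apply/feasible_sums.
Qed.
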